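(* Let $n>1$ be an integer. The set $\{N\in\mathcal{G}_n : \mathbb{F}_n/N \text{ is solvable}\}$ is $\mathbf{\Sigma}^0_2$-complete.
   Context: $\mathbb{F}_n$ is the free group on $\gamma_1,\dots,\gamma_n$. $\mathcal{G}_n$ denotes the set of normal subgroups $N\trianglelefteq\mathbb{F}_n$, viewed as a subset of $\{0,1\}^{\mathbb{F}_n}$ (identifying a subset with its indicator function) with the subspace topology of the product of discrete topologies; it is a compact zero-dimensional Polish space. Each $N\in\mathcal{G}_n$ corresponds to the marked group $G_N=\mathbb{F}_n/N$ with generating tuple $S_N=(\gamma_1N,\dots,\gamma_nN)$. The Borel classes are: $\mathbf{\Sigma}^0_1$ = open sets, $\mathbf{\Pi}^0_\alpha$ = complements of $\mathbf{\Sigma}^0_\alpha$ sets, $\mathbf{\Sigma}^0_\alpha$ ($\alpha>1$) = countable unions of sets in $\bigcup_{\beta<\alpha}\mathbf{\Pi}^0_\beta$. For $\mathbf{\Gamma}$ one of $\mathbf{\Sigma}^0_\alpha,\mathbf{\Pi}^0_\alpha$, a set $A\subseteq X$ is $\mathbf{\Gamma}$-complete if $A\in\mathbf{\Gamma}$ and for every zero-dimensional Polish space $Y$ and every $B\subseteq Y$ in $\mathbf{\Gamma}$ there is a continuous $f:Y\to X$ with $f^{-1}[A]=B$. *)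

(* Defs.v *)
From mathcomp Require Import all_boot.
From Stdlib Require Import Reals.

Set Implicit Arguments.
Unset Strict Implicit.
Unset Printing Implicit Defensive.

(* A letter (i, true) is gamma_i, (i, false) is gamma_i^{-1}.          *)

Definition letter (n : nat) := ('I_n * bool)%type.

Definition inv_letters n (a b : letter n) : bool := (a.1 == b.1) && (a.2 != b.2).

Definition reduced n (w : seq (letter n)) : bool :=
  sorted (fun a b => ~~ inv_letters a b) w.

Definition red_cons n (l : letter n) (w : seq (letter n)) : seq (letter n) :=
  match w with
  | l' :: w' => if inv_letters l l' then w' else l :: w
  | [::] => [:: l]
  end.

Definition normw n (w : seq (letter n)) : seq (letter n) := foldr (@red_cons n) [::] w.

Lemma reduced_red_cons n (l : letter n) w : reduced w -> reduced (red_cons l w).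
Proof.
case: w => [|l' w] //= Hw.
case: ifP => Hinv.
  by move: Hw; rewrite /reduced /=; apply: path_sorted.
by rewrite /reduced /= Hinv.
Qed.

Lemma reduced_normw n (w : seq (letter n)) : reduced (normw w).
Proof. by elim: w => [|l w IH] //=; apply: reduced_red_cons. Qed.

Definition Fn (n : nat) := {w : seq (letter n) | reduced w}.

Definition Fn_of n (w : seq (letter n)) : Fn n := exist _ (normw w) (reduced_normw w).

Definition Fn_one n : Fn n := Fn_of [::].
Definition Fn_mul n (u v : Fn n) : Fn n := Fn_of (proj1_sig u ++ proj1_sig v).
Definition Fn_inv n (u : Fn n) : Fn n :=
  Fn_of (rev (map (fun l : letter n => (l.1, ~~ l.2)) (proj1_sig u))).
Definition gamma n (i : 'I_n) : Fn n := Fn_of [:: (i, true)].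

Definition is_normal n (N : Fn n -> bool) : Prop :=
  [/\ N (Fn_one n),
      (forall u v, N u -> N v -> N (Fn_mul u v)),
      (forall u, N u -> N (Fn_inv u)) &
      (forall u g, N u -> N (Fn_mul (Fn_mul (Fn_inv g) u) g))].

(* Solvability of a group presented as a setoid (carrier, equivalence   *)
(* relation, operations).  The marked quotient group F_n/N is the       *)
(* setoid (F_n, u ~ v iff u^-1 v in N) with the induced operations.     *)

Section SetoidGroup.
Variables (G : Type) (eqv : G -> G -> Prop) (mul : G -> G -> G) (inv : G -> G) (one : G).

Inductive gen_subgroup (S : G -> Prop) : G -> Prop :=
  | gen_in x : S x -> gen_subgroup S x
  | gen_one : gen_subgroup S one
  | gen_mul x y : gen_subgroup S x -> gen_subgroup S y -> gen_subgroup S (mul x y)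
  | gen_inv x : gen_subgroup S x -> gen_subgroup S (inv x)
  | gen_eqv x y : gen_subgroup S x -> eqv x y -> gen_subgroup S y.

Definition commutator (x y : G) : G := mul (mul (inv x) (inv y)) (mul x y).

Fixpoint derived (k : nat) : G -> Prop :=
  match k with
  | 0 => fun _ => True
  | k'.+1 => gen_subgroup (fun z => exists x y,
                 derived k' x /\ derived k' y /\ z = commutator x y)
  end.

Definition solvable_group : Prop := exists k, forall x, derived k x -> eqv x one.
End SetoidGroup.

Definition quot_eqv n (N : Fn n -> bool) (u v : Fn n) : Prop := N (Fn_mul (Fn_inv u) v).

Definition quotient_solvable n (N : Fn n -> bool) : Prop :=
  solvable_group (quot_eqv N) (@Fn_mul n) (@Fn_inv n) (Fn_one n).

Definition prod_open n (U : (Fn n -> bool) -> Prop) : Prop :=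
  forall x, U x -> exists ws : seq (Fn n),
    forall y, (forall w, List.In w ws -> y w = x w) -> U y.

Definition prod_closed n (C : (Fn n -> bool) -> Prop) : Prop :=
  prod_open (fun x => ~ C x).

(* Sigma^0_2 subsets of the subspace G_n = {N | is_normal N}:
   countable unions of relatively closed sets (relatively closed sets
   being the traces on G_n of closed sets of the ambient space). *)
Definition Gn_Sigma02 n (A : (Fn n -> bool) -> Prop) : Prop :=
  (forall N, A N -> is_normal N) /\
  exists C : nat -> (Fn n -> bool) -> Prop,
    (forall k, prod_closed (C k)) /\
    (forall N, is_normal N -> (A N <-> exists k, C k N)).

Section MetricSpace.
Variables (Y : Type) (d : Y -> Y -> R).

Definition is_metric : Prop :=
  (forall x y, (0 <= d x y)%R) /\
  (forall x y, d x y = 0%R <-> x = y) /\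
  (forall x y, d x y = d y x) /\
  (forall x y z, (d x z <= d x y + d y z)%R).

Definition m_open (U : Y -> Prop) : Prop :=
  forall x, U x -> exists eps : R, (0 < eps)%R /\ forall y, (d x y < eps)%R -> U y.

Definition m_closed (C : Y -> Prop) : Prop := m_open (fun y => ~ C y).

Definition m_complete : Prop :=
  forall s : nat -> Y,
    (forall eps : R, (0 < eps)%R -> exists N, forall p q, N <= p -> N <= q ->
        (d (s p) (s q) < eps)%R) ->
    exists l, forall eps : R, (0 < eps)%R -> exists N, forall p, N <= p ->
        (d (s p) l < eps)%R.

Definition m_separable : Prop :=
  exists s : nat -> Y, forall x (eps : R), (0 < eps)%R -> exists k, (d x (s k) < eps)%R.

Definition m_zero_dim : Prop :=
  forall U x, m_open U -> U x ->
    exists V, m_open V /\ m_closed V /\ V x /\ (forall y, V y -> U y).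

Definition zero_dim_polish : Prop :=
  [/\ is_metric, m_complete, m_separable & m_zero_dim].

Definition m_Sigma02 (B : Y -> Prop) : Prop :=
  exists C : nat -> Y -> Prop, (forall k, m_closed (C k)) /\
    (forall y, B y <-> exists k, C k y).
End MetricSpace.

Definition cont_to_prod (Y : Type) (d : Y -> Y -> R) n (f : Y -> (Fn n -> bool)) : Prop :=
  forall U, prod_open U -> m_open d (fun y => U (f y)).

Definition Gn_Sigma02_complete n (A : (Fn n -> bool) -> Prop) : Prop :=
  Gn_Sigma02 A /\
  forall (Y : Type) (d : Y -> Y -> R), zero_dim_polish d ->
  forall B : Y -> Prop, m_Sigma02 d B ->
  exists f : Y -> (Fn n -> bool),
    (forall y, is_normal (f y)) /\ cont_to_prod d f /\
    (forall y, A (f y) <-> B y).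

(* Main.v *)
(* For gap [j] and size [c], let [F_n] act through the wreath product of
   [UT_{c+1}(F_2)] by [Z], one generator being the shift and another one a function
   with the elementary matrices [1 + E_{p,p+1}] as values at the points [(j+1)p].
   The image is solvable; evaluating at [0] shows that its derived length is at
   least [log_2 c]. For large [j] two fixed words of zero shift have commuting images,
   so each element of [F_n''] lies in the kernel [K j c] for all large [j] and
   all [c]. Hence intersecting [{x | x is in K j c for all large j}] with the
   [K j c] for an arbitrary set of active pairs [(j, c)], [c <= j], yields a normal
   subgroup that depends continuously on the set; its quotient is solvable if the
   active [c] are bounded and not solvable if they are unbounded. Writing a
   Sigma^0_2 set as a union of closed sets [C k], each the intersection of countably
   many clopen sets, call [(j, c)] active at [y] if the first [j] clopen sets
   exclude [y] from all [C k], [k <= c]. *)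

From Stdlib Require Import Reals Lra.
From HB Require Import structures.
Require Import Defs.
From mathcomp Require Import all_boot all_algebra zify ring boolp.

Set Implicit Arguments.
Unset Strict Implicit.
Unset Printing Implicit Defensive.

Import GRing.Theory Num.Theory.

(** * The group structure of [Fn] *)

Section FreeGroup.
Variable n : nat.
Implicit Types (l : letter n) (u v w : seq (letter n)) (x y z : Fn n).

Definition flip l : letter n := (l.1, ~~ l.2).

Lemma inv_lettersP l l' : reflect (l' = flip l) (inv_letters l l').
Proof.
case: l l' => [i b] [j c]; rewrite /inv_letters /flip /=.
apply: (iffP andP) => [[/eqP-> Hbc]|[-> ->]]; last by rewrite eqxx; case: b.
by case: b c Hbc => [] [].
Qed.

Lemma flipK : involutive flip.
Proof. by case=> i b; rewrite /flip /= negbK. Qed.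

(** Reducedness matters when the inner step cancels: [w] then starts with [l], and its next letter
    cannot cancel against the outer [l]. *)
Lemma red_consK l w : reduced w -> red_cons l (red_cons (flip l) w) = w.
Proof.
have H k : inv_letters k (flip k) by apply/inv_lettersP.
case: w => [|l' w] /= Hw; first by rewrite H.
case: (inv_lettersP (flip l) l') => [E|Hl] /=; last by rewrite H.
rewrite flipK in E; rewrite {l'}E in Hw *.
case: w Hw => [|k w] //= /andP[Hk _].
by case: (inv_lettersP l k) Hk => // Ek; rewrite Ek H.
Qed.

(** Van der Waerden's trick: letters permute the reduced words, and [normw u] acts as [u] does,
    which yields associativity of [Fn_mul]. *)
Definition act u w := foldr (@red_cons n) w u.

Lemma act_reduced u w : reduced w -> reduced (act u w).
Proof. by move=> Hw; elim: u => //= l u; apply: reduced_red_cons. Qed.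

Lemma act_red_cons l u w : reduced w -> act (red_cons l u) w = red_cons l (act u w).
Proof.
move=> Hw; case: u => [|l' u] //=; case: inv_lettersP => //= ->.
by rewrite red_consK //; apply: act_reduced.
Qed.

Lemma act_normw u w : reduced w -> act (normw u) w = act u w.
Proof. by move=> Hw; elim: u => //= l u IH; rewrite act_red_cons // IH. Qed.

Lemma normw_cat u v : normw (u ++ v) = act u (normw v).
Proof. exact: foldr_cat. Qed.

Lemma normw_id w : reduced w -> normw w = w.
Proof.
elim: w => //= l w IH Hw; rewrite IH; last exact: path_sorted Hw.
by case: w Hw {IH} => //= k w /andP[/negbTE->].
Qed.

Lemma normw_catl u v : normw (normw u ++ v) = normw (u ++ v).
Proof. by rewrite !normw_cat act_normw // reduced_normw. Qed.

Lemma normw_catr u v : normw (u ++ normw v) = normw (u ++ v).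
Proof. by rewrite !normw_cat (normw_id (reduced_normw v)). Qed.

Lemma Fn_ofP x : Fn_of (val x) = x.
Proof. by apply: val_inj; apply: normw_id (valP x). Qed.

Lemma Fn_mulA : associative (@Fn_mul n).
Proof. by move=> x y z; apply: val_inj; rewrite /= normw_catl normw_catr catA. Qed.

Lemma Fn_mul1 : left_id (Fn_one n) (@Fn_mul n).
Proof. exact: Fn_ofP. Qed.

Lemma Fn_mulr1 : right_id (Fn_one n) (@Fn_mul n).
Proof. by move=> x; rewrite /Fn_mul cats0 Fn_ofP. Qed.

Lemma Fn_mulV : right_inverse (Fn_one n) (@Fn_inv n) (@Fn_mul n).
Proof.
move=> x; apply: val_inj; rewrite /= normw_catr.
have H u w : reduced w -> act (u ++ rev (map flip u)) w = w.
  elim: u w => //= l u IH w Hw.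
  rewrite rev_cons -cats1 catA /act foldr_cat /= [foldr _ _ _]IH ?red_consK //.
  exact: reduced_red_cons.
exact: H.
Qed.

Lemma Fn_mulVl : left_inverse (Fn_one n) (@Fn_inv n) (@Fn_mul n).
Proof.
move=> x; rewrite -[LHS]Fn_mulr1 -{1}(Fn_mulV (Fn_inv x)) -Fn_mulA.
by rewrite (Fn_mulA x) Fn_mulV Fn_mul1 Fn_mulV.
Qed.
End FreeGroup.

HB.instance Definition _ n := Choice.on (Fn n).
HB.instance Definition _ n := isGroup.Build (Fn n) (@Fn_mulA n) (@Fn_mul1 n)
  (@Fn_mulr1 n) (@Fn_mulVl n) (@Fn_mulV n).

(** * Solvability of quotients of [Fn] *)

Section Solvability.
Variable n : nat.
Local Open Scope group_scope.
Implicit Types (x y z : Fn n) (N : Fn n -> bool).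

Definition Fn_derived : nat -> Fn n -> Prop :=
  derived eq (@Fn_mul n) (@Fn_inv n) (Fn_one n).

Lemma commutatorE x y : commutator (@Fn_mul n) (@Fn_inv n) x y = [~ x, y].
Proof. exact: esym (mulgA _ _ _). Qed.

Lemma Fn_derivedS_ind k (P : Fn n -> Prop) :
    P 1 -> (forall x y, P x -> P y -> P (x * y)) -> (forall x, P x -> P x^-1) ->
    (forall x y, Fn_derived k x -> Fn_derived k y -> P [~ x, y]) ->
  forall x, Fn_derived k.+1 x -> P x.
Proof.
move=> P1 PM PV PR x; elim=> {x}.
- by move=> _ [x [y [Dx [Dy ->]]]]; rewrite commutatorE; apply: PR.
- exact: P1.
- by move=> x y _ Px _ Py; apply: PM.
- by move=> x _; apply: PV.
- by move=> x _ _ Px <-.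
Qed.

Lemma Fn_derived_comm k x y :
  Fn_derived k x -> Fn_derived k y -> Fn_derived k.+1 [~ x, y].
Proof. by move=> Dx Dy; apply: gen_in; exists x, y; rewrite commutatorE. Qed.

Lemma Fn_derived_le j k x : j <= k -> Fn_derived k x -> Fn_derived j x.
Proof.
suff S i y : Fn_derived i.+1 y -> Fn_derived i y.
  elim: k => [|k IH]; first by case: j.
  by rewrite leq_eqVlt => /orP[/eqP-> //|/IH H /S].
elim: i y => // i IH; apply: Fn_derivedS_ind => [|u v|u|u v].
- exact: gen_one.
- exact: gen_mul.
- exact: gen_inv.
- by move=> /IH Du /IH Dv; apply: Fn_derived_comm.
Qed.

Section Quotient.
Variable N : Fn n -> bool.
Hypothesis normN : is_normal N.

Let N1 : N 1. Proof. by case: normN. Qed.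
Let NM x y : N x -> N y -> N (x * y).
Proof. by case: normN => _ H _ _; apply: H. Qed.
Let NV x : N x -> N x^-1.
Proof. by case: normN => _ _ H _; apply: H. Qed.
Let NJ x y : N x -> N (x ^ y).
Proof. by case: normN => _ _ _ H Nx; rewrite /conjg mulgA; apply: H. Qed.

Lemma quot_eqvP x y : quot_eqv N x y <-> exists2 m, N m & y = x * m.
Proof.
rewrite /quot_eqv; split=> [H|[m Nm ->]]; last by rewrite -[Fn_mul _ _]/(x^-1 * (x * m)) mulKg.
by exists (x^-1 * y); rewrite ?mulVKg.
Qed.

Lemma quot_eqvM x x' y y' :
  quot_eqv N x x' -> quot_eqv N y y' -> quot_eqv N (x * y) (x' * y').
Proof.
move=> /quot_eqvP[m Nm ->] /quot_eqvP[p Np ->]; apply/quot_eqvP.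
exists (m ^ y * p); first by apply: NM => //; apply: NJ.
by rewrite /conjg !mulgA mulgK.
Qed.

Lemma quot_eqvV x x' : quot_eqv N x x' -> quot_eqv N x^-1 x'^-1.
Proof.
move=> /quot_eqvP[m Nm ->]; apply/quot_eqvP.
exists (m^-1 ^ x^-1); first by apply: NJ; apply: NV.
by rewrite /conjg invgK invgM mulKg.
Qed.

Lemma quot_eqvR x x' y y' :
  quot_eqv N x x' -> quot_eqv N y y' -> quot_eqv N [~ x, y] [~ x', y'].
Proof.
move=> Ex Ey; apply: quot_eqvM; first exact: quot_eqvV.
by apply: quot_eqvM; [apply: quot_eqvV|apply: quot_eqvM].
Qed.

Lemma quot_eqv_trans x y z :
  quot_eqv N x y -> quot_eqv N y z -> quot_eqv N x z.
Proof.
move=> /quot_eqvP[m Nm ->] /quot_eqvP[p Np ->]; apply/quot_eqvP.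
by exists (m * p); rewrite ?mulgA //; apply: NM.
Qed.

Lemma quot_eqv_refl x : quot_eqv N x x.
Proof. by apply/quot_eqvP; exists 1; rewrite ?mulg1. Qed.

Let D := derived (quot_eqv N) (@Fn_mul n) (@Fn_inv n) (Fn_one n).

Lemma derived_quot k x : Fn_derived k x -> D k x.
Proof.
elim: k x => // k IH; apply: Fn_derivedS_ind => [|u v|u|u v].
- exact: gen_one.
- exact: gen_mul.
- exact: gen_inv.
- by move=> /IH Du /IH Dv; apply: gen_in; exists u, v; rewrite commutatorE.
Qed.

Lemma derived_quot_lift k x : D k x -> exists2 y, Fn_derived k y & quot_eqv N y x.
Proof.
elim: k x => [|k IH] x; first by exists x => //; apply: quot_eqv_refl.
elim=> {x}.
- move=> _ [x [y [/IH[u Du Eu] [/IH[v Dv Ev] ->]]]]; rewrite commutatorE.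
  by exists [~ u, v]; [apply: Fn_derived_comm|apply: quot_eqvR].
- by exists 1; [apply: gen_one|apply: quot_eqv_refl].
- move=> x y _ [u Du Eu] _ [v Dv Ev].
  by exists (u * v); [apply: gen_mul|apply: quot_eqvM].
- by move=> x _ [u Du Eu]; exists u^-1; [apply: gen_inv|apply: quot_eqvV].
- by move=> x y _ [u Du Eu] Exy; exists u => //; apply: quot_eqv_trans Exy.
Qed.

(** Derived subgroups are verbal, so those of the quotient are the images of those of [Fn n]. *)
Lemma quotient_solvableP :
  quotient_solvable N <-> exists k, forall x, Fn_derived k x -> N x.
Proof.
split=> -[k Hk]; exists k => x.
  move/derived_quot/Hk/quot_eqvP => [m /NV Nm E1].
  by rewrite -(mulgK m x) -E1 [_ * _]mul1g.
move/derived_quot_lift => [y /Hk Ny /quot_eqvP[m Nm ->]].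
by apply/quot_eqvP; exists (y * m)^-1; rewrite ?mulgV //; apply/NV/NM.
Qed.
End Quotient.

(** For fixed [k], containing the [k]-th derived subgroup is a closed condition on [N], since a
    failure shows at a single coordinate. *)
Lemma solvable_Sigma02 :
  Gn_Sigma02 (fun N : Fn n -> bool => is_normal N /\ quotient_solvable N).
Proof.
split=> [N []//|]; exists (fun k N => forall x, Fn_derived k x -> N x); split.
  move=> k N /existsNP[x /not_implyP[Dx Nx]]; exists [:: x] => M /(_ x (or_introl erefl)) E.
  by move=> /(_ _ Dx); rewrite E.
move=> N normN; rewrite -quotient_solvableP //.
by split=> [[]|].
Qed.
End Solvability.

(** * Two-generated subgroups of wreath products of unitriangular groups *)

Section Wreath.
Variables (n j c : nat).
Local Open Scope ring_scope.
Implicit Types (l : letter n) (w : seq (letter n)) (x y : Fn n) (s : int).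
Local Notation M := 'M['F_2]_c.+1.

(* [gamma_1] acts as the generator of [Z], and [gamma_0] as the function
   [base_fun : Z -> UT_{c+1}(F_2)] taking the value [1 + E_{p,p+1}] at
   [(j+1) * p] for [p < c] and [1] elsewhere; all other generators act trivially.
   A word is evaluated to its shift [wexp w] and its function [wmat w].
   The sign of a letter [gamma_0] is irrelevant, [base_fun] being an involution. *)
Definition lexp l : int := if l.1 == 1%N :> nat then if l.2 then 1 else -1 else 0.

Definition wexp w : int := \sum_(l <- w) lexp l.

Definition base_elem s : M :=
  \matrix_(p, q) ((s == (j.+1 * p)%N :> int) && (q == p.+1 :> nat))%:R.

Definition base_fun s : M := 1 + base_elem s.

Definition lmat l s : M := if l.1 == 0%N :> nat then base_fun s else 1.

Fixpoint wmat w s : M := if w is l :: w' then lmat l s * wmat w' (s + lexp l) else 1.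

Lemma addMM (X : M) : X + X = 0.
Proof. by apply/matrixP => p q; rewrite !mxE addrr_pchar2 // pchar_Fp. Qed.

Lemma addr1_sq (E : M) : E * E = 0 -> (1 + E) * (1 + E) = 1.
Proof. by move=> EE; rewrite mulrDl !mulrDr !mul1r mulr1 EE addr0 -addrA addMM addr0. Qed.

(** The point [s] determines the only row that can be nonzero, and the entry in that row is off the
    diagonal. *)
Lemma base_elem_sq s : base_elem s * base_elem s = 0.
Proof.
apply/matrixP => p q; rewrite !mxE big1 // => r _; rewrite !mxE.
case: (s =P (j.+1 * p)%N :> int) => [Ep|]; last by rewrite mul0r.
case: (s =P (j.+1 * r)%N :> int) => [Er|]; last by rewrite mulr0.
case: (r =P p.+1 :> nat) => [E|]; last by rewrite mul0r.
by exfalso; move: Er; rewrite Ep E; lia.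
Qed.

Lemma base_fun_sq s : base_fun s * base_fun s = 1.
Proof. exact: addr1_sq (base_elem_sq s). Qed.

Lemma lexp_flip l : lexp (flip l) = - lexp l.
Proof. by case: l => i []; rewrite /lexp /=; case: ifP; rewrite ?oppr0 ?opprK. Qed.

Lemma lmat_flip l s : lmat l s * lmat (flip l) (s + lexp l) = 1.
Proof.
rewrite /lmat /lexp /=; case: eqP => [->|_]; last by rewrite mulr1.
by rewrite addr0 base_fun_sq.
Qed.

Lemma wexp_cat u v : wexp (u ++ v) = wexp u + wexp v.
Proof. exact: big_cat. Qed.

Lemma wmat_cat u v s : wmat (u ++ v) s = wmat u s * wmat v (s + wexp u).
Proof.
elim: u s => [|l u IH] s /=; first by rewrite /wexp big_nil addr0 mul1r.
by rewrite IH /wexp big_cons mulrA addrA.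
Qed.

Lemma wexp_normw w : wexp (normw w) = wexp w.
Proof.
have S l v : wexp (l :: v) = lexp l + wexp v by exact: big_cons.
elim: w => //= l w; rewrite S => <-.
case: (normw w) => [|l' v] /=; first by rewrite S.
case: (inv_lettersP l l') => [->|_]; last by rewrite S.
by rewrite S lexp_flip addrA subrr add0r.
Qed.

Lemma wmat_normw w s : wmat (normw w) s = wmat w s.
Proof.
elim: w s => //= l w IH s; rewrite -IH.
case: (normw w) => [|l' v] //=; case: (inv_lettersP l l') => [->|_] //=.
by rewrite mulrA lmat_flip mul1r lexp_flip addrK.
Qed.

(** Together with [Fmat] this is the homomorphism into the wreath product, which is never built as a
    group: [FexpM] and [FmatM] state its multiplication law. *)
Definition Fexp x := wexp (val x).
Definition Fmat x s := wmat (val x) s.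

Lemma Fexp1 : Fexp 1%g = 0. Proof. exact: big_nil. Qed.

Lemma Fmat1 s : Fmat 1%g s = 1. Proof. by []. Qed.

Lemma FexpM x y : Fexp (x * y)%g = Fexp x + Fexp y.
Proof. by rewrite /Fexp /= wexp_normw wexp_cat. Qed.

Lemma FmatM x y s : Fmat (x * y)%g s = Fmat x s * Fmat y (s + Fexp x).
Proof. by rewrite /Fmat /= wmat_normw wmat_cat. Qed.

Lemma FexpV x : Fexp x^-1%g = - Fexp x.
Proof. by apply/eqP; rewrite -addr_eq0 -FexpM mulVg Fexp1. Qed.

Lemma FexpR x y : Fexp [~ x, y]%g = 0.
Proof. by rewrite !FexpM !FexpV; lia. Qed.

Lemma FmatV x s : Fmat x^-1%g s * Fmat x (s - Fexp x) = 1.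
Proof. by rewrite -FexpV -FmatM mulVg. Qed.

Lemma FmatV0 x s : Fexp x = 0 -> Fmat x^-1%g s * Fmat x s = 1.
Proof. by move=> ex; rewrite -{2}[s]subr0 -ex FmatV. Qed.

Lemma FmatR x y s : Fexp x = 0 -> Fexp y = 0 ->
  Fmat [~ x, y]%g s = Fmat x^-1%g s * Fmat y^-1%g s * (Fmat x s * Fmat y s).
Proof.
by move=> ex ey; rewrite !FmatM !FexpV ex ey oppr0 !addr0 mulrA.
Qed.

Definition wreath_ker x : Prop := Fexp x = 0 /\ forall s, Fmat x s = 1.

Lemma wreath_ker1 : wreath_ker 1%g.
Proof. by split=> //; apply: Fexp1. Qed.

Lemma wreath_kerM x y : wreath_ker x -> wreath_ker y -> wreath_ker (x * y)%g.
Proof.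
move=> [ex mx] [ey my]; split=> [|s]; first by rewrite FexpM ex ey.
by rewrite FmatM mx my mulr1.
Qed.

Lemma wreath_kerV x : wreath_ker x -> wreath_ker x^-1%g.
Proof.
move=> [ex mx]; split=> [|s]; first by rewrite FexpV ex oppr0.
by have := FmatV x s; rewrite mx mulr1.
Qed.

Lemma wreath_kerJ x y : wreath_ker x -> wreath_ker (x ^ y)%g.
Proof.
move=> [ex mx]; split=> [|s]; first by rewrite !FexpM FexpV ex; lia.
by rewrite !FmatM mx mul1r ex addr0 FexpV FmatV.
Qed.

(** * Unitriangular matrices and the upper bound on the derived length *)

Definition upper k (X : M) : Prop := forall p q : 'I_c.+1, (q < p + k)%N -> X p q = 0.

Lemma upper_le k k' X : (k <= k')%N -> upper k' X -> upper k X.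
Proof. by move=> le_k H p q lt_q; apply: H; lia. Qed.

Lemma upperD k X Y : upper k X -> upper k Y -> upper k (X + Y).
Proof. by move=> HX HY p q lt_q; rewrite !mxE HX // HY // addr0. Qed.

Lemma upperN k X : upper k X -> upper k (- X).
Proof. by move=> HX p q lt_q; rewrite !mxE HX // oppr0. Qed.

Lemma upperM k k' X Y : upper k X -> upper k' Y -> upper (k + k') (X * Y).
Proof.
move=> HX HY p q lt_q; rewrite !mxE big1 // => r _.
have [lt_r|le_r] := ltnP r (p + k)%N; first by rewrite HX // mul0r.
by rewrite HY ?mulr0 //; lia.
Qed.

Lemma upper1 : upper 0 1.
Proof. by move=> p q lt_q; rewrite !mxE; case: eqP => // E; move: lt_q; rewrite E; lia. Qed.

(** For [k >= 1] these matrices form the [k]-th term of the lower central series of the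
    unitriangular group. *)
Definition unip k X := upper k (X - 1).

Lemma unip_upper k X : unip k X -> upper 0 X.
Proof.
by move=> /(upper_le (leq0n k)) H; rewrite -(subrK 1 X); apply: upperD H upper1.
Qed.

Lemma unip1 k : unip k 1.
Proof. by move=> p q _; rewrite subrr mxE. Qed.

Lemma unipM k X Y : unip k X -> unip k Y -> unip k (X * Y).
Proof.
move=> HX HY; rewrite /unip.
have -> : X * Y - 1 = (X - 1) * Y + (Y - 1) by rewrite mulrBl mul1r addrA subrK.
apply: (upperD _ HY); rewrite -[k]addn0; apply: (upperM HX); exact: unip_upper HY.
Qed.

Lemma unipV k X Y : upper 0 Y -> Y * X = 1 -> unip k X -> unip k Y.
Proof.
move=> HY YX /upperN HX; rewrite /unip.
have -> : Y - 1 = Y * - (X - 1) by rewrite opprB mulrBr mulr1 YX.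
exact: (@upperM 0 k).
Qed.

(** Since [Xi * Yi] inverts [Y * X], subtracting 1 leaves [Xi * Yi] times the additive commutator of
    [X - 1] and [Y - 1], in which the depths add. *)
Lemma unipR k X Y Xi Yi : upper 0 Xi -> upper 0 Yi -> Xi * X = 1 -> Yi * Y = 1 ->
  unip k X -> unip k Y -> unip (k + k) (Xi * Yi * (X * Y)).
Proof.
move=> HXi HYi XX YY HX HY; rewrite /unip.
have -> : Xi * Yi * (X * Y) - 1 =
    (Xi * Yi) * ((X - 1) * (Y - 1) + - ((Y - 1) * (X - 1))).
  have -> : (X - 1) * (Y - 1) + - ((Y - 1) * (X - 1)) = X * Y - Y * X.
    rewrite !mulrBl !mulrBr !mul1r !mulr1.
    move: (X * Y) (Y * X) => P Q; apply/matrixP => p q; rewrite !mxE; ring.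
  by rewrite mulrBr [Xi * Yi * (Y * X)]mulrA -(mulrA Xi Yi Y) YY mulr1 XX.
apply: (@upperM 0); first exact: (@upperM 0 0).
by apply: upperD; [apply: upperM|apply: upperN; apply: upperM].
Qed.

Lemma unip_Fmat x s : unip 1 (Fmat x s).
Proof.
rewrite /Fmat; elim: (val x) s => [|l w IH] s /=; first exact: unip1.
apply: unipM (IH _); rewrite /lmat; case: ifP => _; last exact: unip1.
move=> p q lt_q; rewrite /base_fun addrAC subrr add0r mxE.
by case: (q =P p.+1 :> nat) lt_q => [->|_]; [lia|rewrite andbF].
Qed.

Lemma upper0_Fmat x s : upper 0 (Fmat x s).
Proof. exact: unip_upper (unip_Fmat x s). Qed.

(** The first commutators kill the shift; from then on commutators are computed pointwise and
    [unipR] raises the depth. It even doubles, but linear growth suffices. *)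
Lemma derived_unip k x : Fn_derived k.+1 x -> Fexp x = 0 /\ forall s, unip k.+1 (Fmat x s).
Proof.
elim: k x => [|k IH]; apply: Fn_derivedS_ind => [|u v [eu mu] [ev mv]|u [eu mu]|u v].
all: try by [rewrite Fexp1; split=> // s; apply: unip1].
all: try by [rewrite FexpM eu ev; split=> // s; rewrite FmatM; apply: unipM].
all: try by [rewrite FexpV eu oppr0; split=> // s;
  apply: unipV (upper0_Fmat _ _) (FmatV _ _) (mu _)].
  by move=> _ _; rewrite FexpR; split=> // s; apply: unip_Fmat.
move=> /IH[eu mu] /IH[ev mv]; rewrite FexpR; split=> // s.
rewrite FmatR //; apply: (@upper_le _ (k.+1 + k.+1)); first lia.
by apply: unipR; rewrite ?FmatV0 //; apply: upper0_Fmat.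
Qed.

(** The last superdiagonal of a matrix of size [c + 1] is the [c]-th, so depth [c + 1] leaves only
    the identity. *)
Lemma derived_wreath_ker x : Fn_derived c.+1 x -> wreath_ker x.
Proof.
move=> /derived_unip[ex mx]; split=> // s; apply/eqP; rewrite -subr_eq0; apply/eqP.
by apply/matrixP => p q; rewrite mx ?mxE //; have := ltn_ord q; lia.
Qed.

(* A word of length [L] sees the base function only on an interval of radius
   [L], where for large gaps all its values lie in one group of order two. *)
Lemma wmat_local w s (T : M) : T * T = 1 ->
    (forall s', `|s' - s| <= (size w)%:Z -> base_fun s' = 1 \/ base_fun s' = T) ->
  wmat w s = 1 \/ wmat w s = T.
Proof.
move=> TT; elim: w s => [|l w IH] s Hs /=; first by left.
have lexp_le : `|lexp l| <= 1 by rewrite /lexp; case: ifP => _ //; case: l.2.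
have Hl : lmat l s = 1 \/ lmat l s = T.
  by rewrite /lmat; case: ifP => _; [apply: Hs; rewrite subrr normr0|left].
have Hw : wmat w (s + lexp l) = 1 \/ wmat w (s + lexp l) = T.
  by apply: IH => s' Hs'; apply: Hs => /=; lia.
case: Hl Hw => -> [] ->; rewrite ?mul1r ?mulr1 ?TT; tauto.
Qed.

(** Nontrivial values occur only at multiples of [j + 1], and a window of diameter [2 L <= j] holds
    at most one of them. *)
Lemma base_fun_gap L s : (L.*2 <= j)%N -> exists2 T : M, T * T = 1 &
  forall s', `|s' - s| <= L%:Z -> base_fun s' = 1 \/ base_fun s' = T.
Proof.
move=> le_Lj.
have [[s0 [Hs0 N1]]|H] := EM (exists s0, `|s0 - s| <= L%:Z /\ base_fun s0 <> 1); last first.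
  exists 1 => [|s' Hs']; first exact: mulr1.
  by left; apply: contrapT => N1; apply: H; exists s'.
have dvd s' : base_fun s' <> 1 -> exists p : nat, s' = (j.+1 * p)%N :> int.
  move=> N1'; apply: contrapT => Np; apply: N1'.
  rewrite /base_fun; suff -> : base_elem s' = 0 by rewrite addr0.
  by apply/matrixP => p q; rewrite !mxE; case: eqP => // E; case: Np; exists p.
exists (base_fun s0) => [|s' Hs']; first exact: base_fun_sq.
have [->|N1'] := EM (base_fun s' = 1); [by left|right].
have [p Ep] := dvd _ N1; have [q Eq] := dvd _ N1'.
suff -> : s' = s0 by [].
rewrite Ep Eq in Hs0 Hs' *.
case: (ltngtP p q) => [ltpq|ltpq|->//]; exfalso.
  by have : (j.+1 * p.+1 <= j.+1 * q)%N; [rewrite leq_mul2l ltpq orbT|lia].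
by have : (j.+1 * q.+1 <= j.+1 * p)%N; [rewrite leq_mul2l ltpq orbT|lia].
Qed.

(** A window whose radius is the sum of both lengths gives one [T] for [x] and [y], and values in
    the group {1, T} commute. *)
Lemma commg_wreath_ker x y : Fexp x = 0 -> Fexp y = 0 ->
  ((size (val x) + size (val y)).*2 <= j)%N -> wreath_ker [~ x, y]%g.
Proof.
move=> ex ey le_j; split=> [|s]; first exact: FexpR.
have [T TT HT] := base_fun_gap s le_j.
have Hx : Fmat x s = 1 \/ Fmat x s = T.
  by apply: wmat_local => // s' Hs'; apply: HT; lia.
have Hy : Fmat y s = 1 \/ Fmat y s = T.
  by apply: wmat_local => // s' Hs'; apply: HT; lia.
have C : Fmat x s * Fmat y s = Fmat y s * Fmat x s.
  by case: Hx Hy => -> [] ->; rewrite ?mul1r ?mulr1.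
by rewrite FmatR // C -mulrA (mulrA (Fmat y^-1%g s)) !FmatV0 // mul1r FmatV0.
Qed.

(** For the involutions [1 + E] and [1 + F] the square of the product is their commutator; with
    elementary matrices this is the Steinberg relation [1 + E_{u,v}, 1 + E_{v,w}] = 1 + E_{u,w}. *)
Lemma addr1_mul_sq (E F : M) : E * E = 0 -> F * F = 0 -> F * E = 0 ->
  ((1 + E) * (1 + F)) * ((1 + E) * (1 + F)) = 1 + E * F.
Proof.
move=> EE FF FE.
have swap : (1 + E) * (1 + F) = (1 + F) * (1 + E) + E * F.
  rewrite !mulrDl !mulrDr !mul1r !mulr1 FE.
  by rewrite addr0 !addrA (addrAC 1 F E).
rewrite {2}swap mulrDr -mulrA (mulrA (1 + F)) (addr1_sq FF) mul1r (addr1_sq EE).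
congr (_ + _); rewrite -mulrA (mulrDl 1 F) mul1r (mulrA F) FE mul0r addr0.
by rewrite mulrDl mul1r mulrA EE mul0r addr0.
Qed.

(** * Lower bound on the derived length *)

Hypothesis n_gt1 : (1 < n)%N.

Let a : Fn n := gamma (Ordinal (ltnW n_gt1)).
Let t : Fn n := gamma (Ordinal n_gt1).

Lemma Fexp_a : Fexp a = 0.
Proof. by rewrite /Fexp /= /wexp big_seq1. Qed.

Lemma Fexp_t : Fexp t = 1.
Proof. by rewrite /Fexp /= /wexp big_seq1. Qed.

Lemma Fmat_a s : Fmat a s = base_fun s.
Proof. by rewrite /Fmat /= mulr1. Qed.

Lemma Fmat_t s : Fmat t s = 1.
Proof. by rewrite /Fmat /= mulr1. Qed.

Lemma Fexp_tX m : Fexp (t ^+ m)%g = m%:Z.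
Proof.
elim: m => [|m IH]; first exact: Fexp1.
by rewrite expgS FexpM IH Fexp_t; lia.
Qed.

Lemma Fmat_tX m s : Fmat (t ^+ m)%g s = 1.
Proof.
elim: m s => [|m IH] s; first exact: Fmat1.
by rewrite expgS FmatM IH Fmat_t mulr1.
Qed.

(** Iterated commutators build elementary matrices at the point 0, each step joining two adjacent
    intervals of length 2^k into one of length 2^{k+1}. *)
Lemma derived_not_wreath_ker k :
  (2 ^ k <= c)%N -> exists2 x, Fn_derived k x & ~ wreath_ker x.
Proof.
move=> le_kc.
pose el (p q : nat) : M := delta_mx (inord p) (inord q).
(* The left end [u] has to vary, as the second interval starts at [u + 2 ^ k]. *)
suff H : forall u, (u + 2 ^ k <= c)%N ->
    exists x, [/\ Fn_derived k x, Fexp x = 0 & Fmat x 0 = 1 + el u (u + 2 ^ k)%N].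
  have [x [Dx _ mx]] := H 0%N le_kc; exists x => // -[_ /(_ 0)].
  rewrite mx => /matrixP/(_ (inord 0) (inord (2 ^ k))) /eqP.
  by rewrite !mxE !eqxx addrC -subr_eq0 addrK oner_eq0.
elim: k {le_kc} => [|k IH] u le_u.
  (* Conjugation by this power of [t] brings the value 1 + E_{u,u+1}, which [base_fun] takes at
     (j+1)u, to the point 0. *)
  exists (t ^+ (j.+1 * u) * a * (t ^+ (j.+1 * u))^-1)%g; split=> //.
    by rewrite !FexpM FexpV Fexp_a; lia.
  rewrite !FmatM Fexp_tX Fmat_tX Fmat_a.
  have -> z : Fmat (t ^+ (j.+1 * u))^-1%g z = 1.
    by have := FmatV (t ^+ (j.+1 * u))%g z; rewrite Fmat_tX mulr1.
  rewrite mulr1 mul1r add0r /base_fun; congr (_ + _).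
  apply/matrixP => p q; rewrite !mxE; congr (_%:R); congr (nat_of_bool _).
  rewrite -!val_eqE /= !inordK; [|lia..].
  rewrite eqz_nat eqn_pmul2l // eq_sym.
  by case: eqP => //= ->; rewrite addn1.
have [x [Dx ex mx]] := IH u ltac:(rewrite expnS in le_u; lia).
have [y [Dy ey my]] := IH (u + 2 ^ k)%N ltac:(rewrite expnS in le_u; lia).
exists [~ x, y]%g; split; [exact: Fn_derived_comm|exact: FexpR|].
set v := (u + 2 ^ k)%N in my *; set w := (v + 2 ^ k)%N in my.
have -> : (u + 2 ^ k.+1 = w)%N by rewrite /w /v expnS; lia.
have lt_uv : (u < v)%N by rewrite /v -addn1 leq_add2l expn_gt0.
have lt_vw : (v < w)%N by rewrite /w -addn1 leq_add2l expn_gt0.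
have le_wc : (w <= c)%N by rewrite /w /v; move: le_u; rewrite expnS; lia.
have inord_neq p q : (p < q)%N -> (q <= c)%N -> (inord q == inord p :> 'I_c.+1) = false.
  by move=> lt_pq le_qc; rewrite -val_eqE /= !inordK; lia.
have E0 p p' q q' : (q < p')%N -> (p' <= c)%N -> el p q * el p' q' = 0.
  by move=> lt_qp le_p; apply: mul_delta_mx_0; rewrite eq_sym inord_neq.
have E0' p p' q q' : (p' < q)%N -> (q <= c)%N -> el p q * el p' q' = 0.
  by move=> lt_qp le_p; apply: mul_delta_mx_0; rewrite inord_neq.
have inv_self (X Z : M) : Z * X = 1 -> X * X = 1 -> Z = X.
  by move=> ZX XX; rewrite -[Z]mulr1 -XX mulrA ZX mul1r.
have sq p q : (p < q)%N -> (q <= c)%N -> (1 + el p q) * (1 + el p q) = 1.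
  by move=> lt_pq le_qc; apply/addr1_sq/E0'.
have mxV : Fmat x^-1%g 0 = 1 + el u v.
  by rewrite -mx; apply: inv_self (FmatV0 0 ex) _; rewrite mx sq //; lia.
have myV : Fmat y^-1%g 0 = 1 + el v w.
  by rewrite -my; apply: inv_self (FmatV0 0 ey) _; rewrite my sq.
rewrite FmatR // mxV myV mx my addr1_mul_sq; first by congr (_ + _); apply: mul_delta_mx.
- by apply: E0'; lia.
- by apply: E0'.
- by apply: E0'; lia.
Qed.
End Wreath.

(** * Zero-dimensional separable metric spaces *)

Section Metric.
Variables (Y : Type) (d : Y -> Y -> R).
Hypothesis d_metric : is_metric d.
Local Open Scope R_scope.
Implicit Types (P Q : Y -> Prop) (y : Y).

(** Required at every [y], this means that [P] is clopen; the pointwise form passes easily through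
    finite Boolean combinations. *)
Definition locally_const P y :=
  exists eps : R, 0 < eps /\ forall y', d y y' < eps -> (P y' <-> P y).

Definition clopen P := m_open d P /\ m_closed d P.

Lemma locally_const_true y : locally_const (fun=> True) y.
Proof. by exists 1; split=> //; lra. Qed.

Lemma locally_const_and P Q y :
  locally_const P y -> locally_const Q y -> locally_const (fun z => P z /\ Q z) y.
Proof.
move=> [e [e0 He]] [f [f0 Hf]]; exists (Rmin e f); split; first by apply: Rmin_glb_lt.
move=> z Hz; have := Rmin_l e f; have := Rmin_r e f => Hr Hl.
by rewrite He ?Hf //; lra.
Qed.

Lemma locally_const_not P y : locally_const P y -> locally_const (fun z => ~ P z) y.
Proof. by move=> [e [e0 He]]; exists e; split=> // z /He ->. Qed.

Lemma locally_const_iff P Q y : (forall z, P z <-> Q z) -> locally_const P y -> locally_const Q y.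
Proof. by move=> PQ [e [e0 He]]; exists e; split=> // z /He; rewrite -!PQ. Qed.

Lemma locally_const_imp P Q y :
  locally_const P y -> locally_const Q y -> locally_const (fun z => P z -> Q z) y.
Proof.
move=> HP /locally_const_not HQ.
apply: (locally_const_iff _ (locally_const_not (locally_const_and HP HQ))) => z.
by rewrite not_andP notK; tauto.
Qed.

Lemma locally_const_forall (m : nat) (P : nat -> Y -> Prop) y :
  (forall i, locally_const (P i) y) ->
  locally_const (fun z => forall i, (i < m)%N -> P i z) y.
Proof.
move=> HP; elim: m => [|m IH].
  by apply: (locally_const_iff _ (locally_const_true y)).
apply: (locally_const_iff _ (locally_const_and (HP m) IH)) => z; split.
  by move=> [Pm Pl] i; rewrite ltnS leq_eqVlt => /orP[/eqP->|/Pl].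
by move=> H; split=> [|i lt_im]; apply: H => //; apply: ltnW.
Qed.

Lemma locally_const_forall_In (T : Type) (ws : seq T) (P : T -> Y -> Prop) y :
  (forall x, locally_const (P x) y) ->
  locally_const (fun z => forall x, List.In x ws -> P x z) y.
Proof.
move=> HP; elim: ws => [|w ws IH].
  by apply: (locally_const_iff _ (locally_const_true y)).
apply: (locally_const_iff _ (locally_const_and (HP w) IH)) => z; split.
  by move=> [Pw Pl] x [<-|/Pl].
by move=> H; split=> [|x Hx]; apply: H; [left|right].
Qed.

Lemma locally_const_exists (m : nat) (P : nat -> Y -> Prop) y :
  (forall i, locally_const (P i) y) ->
  locally_const (fun z => exists2 i, (i < m)%N & P i z) y.
Proof.
move=> HP; have H i : locally_const (fun z => ~ P i z) y by apply: locally_const_not.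
apply: (locally_const_iff _ (locally_const_not (locally_const_forall m H))) => z; split.
  by move=> /existsNP[i /not_implyP[lt_im /contrapT Pi]]; exists i.
by move=> [i lt_im Pi] /(_ i lt_im).
Qed.

Lemma clopen_locally_const P y : clopen P -> locally_const P y.
Proof.
move=> [oP cP]; have [Py|Py] := EM (P y).
  by have [e [e0 He]] := oP y Py; exists e; split=> // z /He; tauto.
by have [e [e0 He]] := cP y Py; exists e; split=> // z /He; tauto.
Qed.

Lemma clopen_not P : clopen P -> clopen (fun z => ~ P z).
Proof.
move=> [oP cP]; split=> // y /contrapT Py; have [e [e0 He]] := oP y Py.
by exists e; split=> // z /He Pz; apply.
Qed.

(** A Lindelöf argument: there are countably many balls with radius 1/b and centre in a dense
    sequence, and one clopen set disjoint from [P] is enough for each ball that some such set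
    covers. *)
Lemma closed_eq_bigcap_clopen P : m_separable d -> m_zero_dim d -> m_closed d P ->
  exists W : nat * nat -> Y -> Prop,
    (forall i, clopen (W i)) /\ forall y, P y <-> forall i, W i y.
Proof.
move=> [s sP] zd cP.
pose ball (i : nat * nat) y := d (s i.1) y < / INR i.2.
pose sep i V := clopen V /\ (forall y, P y -> ~ V y) /\ forall y, ball i y -> V y.
(* [W i] is the complement of the chosen clopen set, or the whole space if there is none. The junk
   radius at [b = 0] does no harm, as [W i] contains [P] in any case. *)
have /choice[W HW] (i : nat * nat) : exists V, clopen V /\
    (forall y, P y -> V y) /\ ((exists V', sep i V') -> forall y, ball i y -> ~ V y).
  have [[V [clV [PV sV]]]|H] := EM (exists V, sep i V).
    exists (fun z => ~ V z); split; first exact: clopen_not.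
    by split=> // _ y /sV Vy; apply.
  exists (fun=> True); split=> //; split=> [y _|y [] //].
  by exists 1; split=> //; lra.
exists W; split=> [i|y]; first by case: (HW i).
split=> [Py i|Wy]; first by case: (HW i) => _ [H _]; apply: H.
apply: contrapT => Py; have [d0 [_ [dC dT]]] := d_metric.
have [V [oV [cV [Vy VP]]]] := zd _ y cP Py.
have [e [e0 He]] := oV y Vy.
(* Two points of a ball of radius 1/b < e/2 are less than [e] apart, so a ball of this radius
   containing [y] stays inside [V]. *)
have [b [b_e b0]] := archimed_cor1 (e / 2) ltac:(lra).
have b_pos : 0 < / INR b by apply/Rinv_0_lt_compat/lt_0_INR.
have [a sa] := sP y _ b_pos.
have [_ [_ H]] := HW (a, b); apply: (H _ y) (Wy (a, b)); last by rewrite /ball dC.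
exists V; split=> //; split=> [z Pz /VP //|z Hz]; apply: He; move: Hz; rewrite /ball /= => Hz.
by have := dT y (s a) z; lra.
Qed.

Lemma Sigma02_counter (B : Y -> Prop) :
    m_separable d -> m_zero_dim d -> m_Sigma02 d B ->
  exists active : Y -> nat -> nat -> Prop,
  [/\ forall j c y, locally_const (fun z => active z j c) y,
      forall y, B y -> exists k, forall j c, active y j c -> (c < k)%N &
      forall y, ~ B y -> forall c, exists2 j, (c <= j)%N & active y j c].
Proof.
move=> sepd zd [C [clC BC]].
have [W HW] := choice (fun k => closed_eq_bigcap_clopen sepd zd (clC k)).
(* Bounding [a] and [b] by [j] leaves finitely many clopen conditions and makes activity monotone in
   [j]. *)
exists (fun y j c => forall k, (k < c.+1)%N -> exists2 a, (a < j)%N &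
  exists2 b, (b < j)%N & ~ W k (a, b) y); split.
- move=> j c y; apply: locally_const_forall => k.
  apply: locally_const_exists => a; apply: locally_const_exists => b.
  by apply: locally_const_not; apply: clopen_locally_const; case: (HW k).
- move=> y /BC[k Ck]; exists k => j c act; rewrite ltnNge; apply/negP => le_kc.
  by have [a _ [b _]] := act k le_kc; apply; have [_ /(_ y)[H _]] := HW k; apply: H.
move=> y NB c.
have H k : exists a b, ~ W k (a, b) y.
  apply: contrapT => N; apply: NB; apply/BC; exists k; have [_ /(_ y)[_]] := HW k.
  by apply=> -[a b]; apply: contrapT => Nab; apply: N; exists a, b.
suff [j0 Hj0] : exists j, forall k, (k < c.+1)%N -> exists2 a, (a < j)%N &
    exists2 b, (b < j)%N & ~ W k (a, b) y.
  (* Monotonicity in [j] allows the bound to be raised to reach [c <= j]. *)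
  exists (maxn c j0) => [|k /Hj0[a lt_a [b lt_b Nab]]]; first exact: leq_maxl.
  by exists a; [|exists b]; rewrite // leq_max ?lt_a ?lt_b orbT.
elim: c.+1 => [|m [j IH]]; first by exists 0%N.
have [a [b Nab]] := H m; exists (maxn j (maxn a b).+1) => k.
rewrite ltnS leq_eqVlt => /orP[/eqP->|/IH[a' lt_a [b' lt_b Nab']]].
  by exists a; [|exists b]; rewrite // !(leq_max, ltnS) leqnn ?orbT.
by exists a'; [|exists b']; rewrite // leq_max ?lt_a ?lt_b.
Qed.
End Metric.

(** * The continuous reduction *)

Section Reduction.
Variable n : nat.
Implicit Types (x : Fn n) (active : nat -> nat -> Prop).

Definition limit_ker x := exists J, forall j c, J <= j -> wreath_ker j c x.

(* Membership in the intersection is decided by [active] below the bound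
   furnished by [limit_ker]: this is the source of continuity. *)
Definition reduction_ker active x := limit_ker x /\
  forall j c, c <= j -> active j c -> wreath_ker j c x.

(** Elements of the derived subgroup have zero shift, so [commg_wreath_ker] applies to commutators
    of two of them, with a bound independent of [c]. *)
Lemma derived2_limit_ker x : Fn_derived 2 x -> limit_ker x.
Proof.
apply: Fn_derivedS_ind => [|u v [J HJ] [L HL]|u [J HJ]|u v Du Dv].
- by exists 0 => j c _; apply: wreath_ker1.
- exists (maxn J L) => j c; rewrite geq_max => /andP[leJ leL].
  by apply: wreath_kerM; [apply: HJ|apply: HL].
- by exists J => j c leJ; apply/wreath_kerV/HJ.
exists (size (val u) + size (val v)).*2 => j c le_j.
have [eu _] := derived_unip j c Du; have [ev _] := derived_unip j c Dv.
exact: commg_wreath_ker.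
Qed.

Lemma is_normal_reduction_ker active : is_normal (fun x => `[< reduction_ker active x >]).
Proof.
split.
- apply/asboolP; split=> [|j c _ _]; last exact: wreath_ker1.
  by exists 0 => j c _; apply: wreath_ker1.
- move=> x y /asboolP[[J HJ] Kx] /asboolP[[L HL] Ky]; apply/asboolP; split.
    exists (maxn J L) => j c; rewrite geq_max => /andP[leJ leL].
    by apply: wreath_kerM; [apply: HJ|apply: HL].
  by move=> j c le_cj act; apply: wreath_kerM; [apply: Kx|apply: Ky].
- move=> x /asboolP[[J HJ] Kx]; apply/asboolP; split.
    by exists J => j c leJ; apply/wreath_kerV/HJ.
  by move=> j c le_cj act; apply/wreath_kerV/Kx.
- move=> x y /asboolP[[J HJ] Kx]; apply/asboolP.
  rewrite -[Fn_mul _ _]/(y^-1 * x * y)%g -mulgA; split.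
    by exists J => j c leJ; apply/wreath_kerJ/HJ.
  by move=> j c le_cj act; apply/wreath_kerJ/Kx.
Qed.

Lemma reduction_ker_solvable active k : (forall j c, active j c -> c < k) ->
  quotient_solvable (fun x => `[< reduction_ker active x >]).
Proof.
move=> act_lt; apply/(quotient_solvableP (is_normal_reduction_ker active)).
(* The 2 serves [limit_ker], and [k] serves the kernels, as active pairs have [c + 1 <= k]. *)
exists k.+2 => x Dx; apply/asboolP; split.
  by apply: derived2_limit_ker; apply: Fn_derived_le Dx.
move=> j c _ /act_lt lt_ck; apply: derived_wreath_ker.
by apply: Fn_derived_le Dx; apply: leqW; apply: leqW.
Qed.

Lemma reduction_ker_unsolvable active : 1 < n ->
    (forall c, exists2 j, c <= j & active j c) ->
  ~ quotient_solvable (fun x => `[< reduction_ker active x >]).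
Proof.
move=> n_gt1 act_ex; case/(quotient_solvableP (is_normal_reduction_ker active)) => k Hk.
have [j le_j act] := act_ex (2 ^ k).
have [x Dx Kx] := derived_not_wreath_ker j n_gt1 (leqnn (2 ^ k)).
by have /asboolP[_ H] := Hk x Dx; apply: Kx; apply: H.
Qed.

(** Outside [limit_ker] membership is constantly false. Otherwise pairs with [j >= J] impose
    nothing, and finitely many pairs [c <= j < J] remain. *)
Lemma reduction_ker_locally_const (Y : Type) (d : Y -> Y -> R)
    (active : Y -> nat -> nat -> Prop) x (y : Y) :
  (forall j c y, locally_const d (fun z => active z j c) y) ->
  locally_const d (fun z => reduction_ker (active z) x) y.
Proof.
move=> lc; have [[J HJ]|N] := EM (limit_ker x); last first.
  apply: (locally_const_iff _ (locally_const_not (locally_const_true d y))) => z.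
  by split=> // -[].
have H : locally_const d (fun z => forall j, j < J -> forall c, c < j.+1 ->
    active z j c -> wreath_ker j c x) y.
  apply: locally_const_forall => j; apply: locally_const_forall => c.
  apply: locally_const_imp => //; have [K|K] := EM (wreath_ker j c x).
    by apply: (locally_const_iff _ (locally_const_true d y)).
  by apply: (locally_const_iff _ (locally_const_not (locally_const_true d y))) => z; tauto.
apply: (locally_const_iff _ H) => z; split=> [Hz|[_ Hz] j _ c]; last by rewrite ltnS; apply: Hz.
split=> [|j c le_cj]; first by exists J.
by have [lt_jJ|le_Jj] := ltnP j J; [apply: Hz|move=> _; apply: HJ].
Qed.

Lemma locally_const_cont_to_prod (Y : Type) (d : Y -> Y -> R) (f : Y -> Fn n -> bool) :
  (forall y x, locally_const d (fun z => f z x) y) -> cont_to_prod d f.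
Proof.
move=> lc U oU y Uy; have [ws Hws] := oU _ Uy.
have [e [e0 He]] : locally_const d (fun z => forall x, List.In x ws -> f z x = f y x) y.
  apply: locally_const_forall_In => x; have [e [e0 He]] := lc y x.
  by exists e; split=> // z /He Ez; split=> // _; apply/idP/idP => /Ez.
by exists e; split=> // z /He Hz; apply: Hws; apply/Hz.
Qed.
End Reduction.

Theorem mainTheorem1 (n : nat) (hn : 1 < n) :
  Gn_Sigma02_complete (fun N : Fn n -> bool => is_normal N /\ quotient_solvable N).
Proof.
split=> [|Y d [dm _ sepd zd] B /(Sigma02_counter dm sepd zd)[active [lc actB actNB]]].
  exact: solvable_Sigma02.
exists (fun y x => `[< reduction_ker (active y) x >]); split.
  by move=> y; apply: is_normal_reduction_ker.
split.
  apply: locally_const_cont_to_prod => y x.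
  apply: (locally_const_iff _ (reduction_ker_locally_const x y lc)) => z.
  by split=> /asboolP.
move=> y; split=> [[_ sol]|By].
  by apply: contrapT => NB; apply: reduction_ker_unsolvable sol => //; apply: actNB.
split; first exact: is_normal_reduction_ker.
by have [k Hk] := actB y By; apply: reduction_ker_solvable Hk.
Qed.
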